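(* For $i=1,2,3$, let $\Phi_i:\mathbb{T}^{n_i}\times N_i\to N_i$ be a regular torification of the connected dually flat space $(M_i,h_i,\nabla_i)$ of dimension $n_i$, with compatible covering map $\tau_i:TM_i\to N_i^\circ$. Let $f_1:M_1\to M_2$ and $f_2:M_2\to M_3$ be isometric affine immersions. Then: (1) $m_{\tau_3\tau_1}(f_2\circ f_1)=m_{\tau_3\tau_2}(f_2)\circ m_{\tau_2\tau_1}(f_1)$. (2) $m_{\tau_1\tau_1}(\mathrm{Id}_{M_1})=\mathrm{Id}_{N_1}$. (3) $\rho_{\tau_3\tau_1}(f_2\circ f_1)=\rho_{\tau_3\tau_2}(f_2)\circ\rho_{\tau_2\tau_1}(f_1)$. (4) $\rho_{\tau_1\tau_1}(\mathrm{Id}_{M_1})=\mathrm{Id}_{\mathbb{T}^{n_1}}$. Here $\mathrm{Id}$ denotes identity maps.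
   Context: Dually flat spaces. A linear connection is flat if its torsion and curvature both vanish. If $(M,h)$ is a Riemannian manifold with a linear connection $\nabla$, the dual connection $\nabla^*$ is the unique linear connection with $Xh(Y,Z)=h(\nabla_XY,Z)+h(Y,\nabla^*_XZ)$ for all vector fields $X,Y,Z$. The triple $(M,h,\nabla)$ is a dually flat space if $\nabla$ and $\nabla^*$ are both flat. A coordinate system $(x_1,\dots,x_n)$ is $\nabla$-affine if $\nabla_{\partial/\partial x_i}\partial/\partial x_j=0$ for all $i,j$. A smooth map $f:M\to M'$ between dually flat spaces is affine if around every point of $M$ (and its image) there are $\nabla$-affine and $\nabla'$-affine coordinate systems in which $f$ is the restriction of an affine map $y\mapsto Ay+B$; it is isometric if $f^*h'=h$. Kähler structure on $TM$ (Dombrowski). Let $(M,h,\nabla)$ be dually flat, $\pi:TM\to M$ the projection, and $K:TTM\to TM$ the connector of $\nabla$ (the map, linear on each $T_u(TM)$, with $K(Y_*X)=\nabla_XY$ for all vector fields). For $u\in T_pM$ the map $A\mapsto(\pi_*A,KA)$ identifies $T_u(TM)$ with $T_pM\oplus T_pM$; under it set $g_u((v,w),(v',w'))=h_p(v,v')+h_p(w,w')$, $J_u(v,w)=(-w,v)$, $\omega_u((v,w),(v',w'))=h_p(v,w')-h_p(w,v')$. This makes $TM$ a Kähler manifold, and $TM$ always carries this structure. Parallel lattices. Let $(M,h,\nabla)$ be connected, $\dim M=n$. A parallel lattice is a subset $L\subset TM$ of the form $L=\{\sum_i k_iX_i(p)\mid p\in M,\ k_i\in\mathbb{Z}\}$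 where $X=(X_1,\dots,X_n)$ are $\nabla$-parallel vector fields forming a basis of $T_pM$ at every $p$; $X$ is called a generator of $L$. $\Gamma(L)$ is the group of maps $TM\to TM$, $u\mapsto u+\sum_ik_iX_i$ ($k\in\mathbb{Z}^n$); it does not depend on the generator, acts freely and properly by holomorphic isometries, and $M_L=TM/\Gamma(L)$ carries the quotient Kähler structure, with quotient map $q_L:TM\to M_L$. Put $\mathbb{T}^n=\mathbb{R}^n/\mathbb{Z}^n$; for a generator $X$ let $\Phi_X([t],q_L(u))=q_L(u+\sum_it_iX_i)$, an action of $\mathbb{T}^n$ on $M_L$. Torifications. Let $N$ be a connected Kähler manifold of real dimension $2n$ with an effective holomorphic isometric action $\Phi:\mathbb{T}^n\times N\to N$; write $\Phi_a=\Phi(a,\cdot)$ and let $N^\circ$ be the set of points where $\Phi$ is free. $N$ (or $\Phi$) is a torification of the connected $n$-dimensional dually flat space $(M,h,\nabla)$ if there is a toric parametrization, i.e. a triple $(L,X,F)$ where $L$ is a parallel lattice generated by $X$ and $F:M_L\to N^\circ$ is a holomorphic isometric diffeomorphism with $F\circ(\Phi_X)_a=\Phi_a\circ F$ for all $a\in\mathbb{T}^n$. A compatible covering map is a map $\tau:TM\to N^\circ$ of the form $\tau=F\circ q_L$ for some toric parametrization $(L,X,F)$. A Kähler manifold is regular if it is connected, simply connected, complete and its Kähler metric is real analytic; a torification is regular if $N$ is regular. Lifts. Let $\Phi:\mathbb{T}^n\times N\to N$ and $\Phi':\mathbb{T}^d\times N'\to N'$ be regular torifications of $(M,h,\nabla)$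 and $(M',h',\nabla')$, with compatible covering maps $\tau,\tau'$, and let $f:M\to M'$ be an isometric affine immersion. It is known that there is a unique smooth map $m:N\to N'$ with $m\circ\tau=\tau'\circ f_*$ (the lift of $f$ with respect to $\tau$ and $\tau'$); it is denoted $m_{\tau'\tau}(f)$. There is also a unique Lie group homomorphism $\rho:\mathbb{T}^n\to\mathbb{T}^d$ with $m_{\tau'\tau}(f)\circ\Phi_a=\Phi'_{\rho(a)}\circ m_{\tau'\tau}(f)$ for all $a\in\mathbb{T}^n$; it is denoted $\rho_{\tau'\tau}(f)$. *)

(* Defs.v *)
From HB Require Import structures.
From mathcomp Require Import all_boot all_order all_algebra.
From mathcomp Require Import ring_quotient.
From mathcomp Require Import all_classical all_reals all_analysis.

Set Implicit Arguments.
Unset Strict Implicit.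
Unset Printing Implicit Defensive.

Import Order.TTheory GRing.Theory Num.Theory.
Import numFieldNormedType.Exports.

Local Open Scope classical_set_scope.
Local Open Scope ring_scope.

(* [Ck k U f] is the class C^k of [f] on the open set [U]; in finite dimension
   it is enough to control the directional derivatives one by one. *)
Fixpoint Ck (R : realType) (V W : normedModType R) (k : nat) (U : set V)
    (f : V -> W) : Prop :=
  if k is j.+1 then
    (forall x, U x -> differentiable f x) /\
    (forall v, Ck j U (fun x => 'D_v f x))
  else forall x, U x -> {for x, continuous f}.

Definition smooth_on (R : realType) (V W : normedModType R) (U : set V)
    (f : V -> W) : Prop :=
  forall k, Ck k U f.

Definition smooth_near (R : realType) (V W : normedModType R) (x : V)
    (f : V -> W) : Prop :=
  exists U : set V, [/\ open U, U x & smooth_on U f].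

(* Sum of an absolutely convergent power series near [x]; the multi-indices
   [al] are grouped by total degree [k], so their entries are at most [k]. *)
Definition analytic_at (R : realType) (m : nat) (f : 'rV[R]_m -> R)
    (x : 'rV[R]_m) : Prop :=
  exists (a : ('I_m -> nat) -> R) (r : R), 0 < r /\
  forall y : 'rV[R]_m, `|y| < r ->
    cvgn (series (fun k : nat =>
      \sum_(al : {ffun 'I_m -> 'I_k.+1} | (\sum_i al i == k)%N)
        (`|a (fun i => al i : nat)| * \prod_i `|y ord0 i| ^+ al i))) /\
    series (fun k : nat =>
      \sum_(al : {ffun 'I_m -> 'I_k.+1} | (\sum_i al i == k)%N)
        (a (fun i => al i : nat) * \prod_i y ord0 i ^+ al i)) @ \oo
      --> f (x + y).

(* [cmap] is meaningful on [cdom] only, and [cinv] on the image of [cdom]. *)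
Record chart (R : realType) (V : normedModType R) (T : Type) := Chart {
  cdom : set T;
  cmap : T -> V;
  cinv : V -> T }.

HB.instance Definition _ (R : realType) (V : normedModType R) (T : Type) :=
  gen_eqMixin (chart V T).
HB.instance Definition _ (R : realType) (V : normedModType R) (T : Type) :=
  gen_choiceMixin (chart V T).

(* A set with an atlas modelled on [V], without any axiom: the axioms of a
   manifold are in [is_manifold] below. *)
Record charted (R : realType) (V : normedModType R) := Charted {
  point_of :> Type;
  atlas : set (chart V point_of) }.

Definition cimg (R : realType) (V : normedModType R) (T : Type)
    (c : chart V T) : set V :=
  cmap c @` cdom c.

HB.instance Definition _ (R : realType) (V : normedModType R) (X : charted V) :=
  gen_eqMixin (point_of X).
HB.instance Definition _ (R : realType) (V : normedModType R) (X : charted V) :=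
  gen_choiceMixin (point_of X).

(* The topology induced by the atlas: in every chart, [W] is read as a
   relatively open subset of the image of the chart. *)
Definition charted_open (R : realType) (V : normedModType R) (X : charted V)
    (W : set (point_of X)) : Prop :=
  forall c, atlas c -> exists2 O : set V, open O &
    forall x, cimg c x -> (W (cinv c x) <-> O x).

Lemma charted_openT (R : realType) (V : normedModType R) (X : charted V) :
  @charted_open R V X setT.
Proof. by move=> c _; exists setT; [exact: openT|]. Qed.

Lemma charted_openI (R : realType) (V : normedModType R) (X : charted V) :
  setI_closed (@charted_open R V X).
Proof.
move=> A B oA oB c ac.
have [P oP hP] := oA c ac; have [Q oQ hQ] := oB c ac.
exists (P `&` Q); first exact: openI.
by move=> x cx; split=> -[hA hB]; split; by [apply/hP|apply/hQ].
Qed.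

Lemma charted_open_bigU (R : realType) (V : normedModType R) (X : charted V)
    (I : Type) (f : I -> set (point_of X)) :
  (forall i, charted_open (f i)) -> charted_open (\bigcup_i f i).
Proof.
move=> of_ c ac.
exists (\bigcup_(O in [set O : set V | open O /\ exists i,
  forall x, cimg c x -> O x -> f i (cinv c x)]) O).
  by apply: bigcup_open => O [].
move=> x cx; split=> [[i _ fix_] | [B [_ [i hO]] Ox]]; last first.
  by exists i => //; exact: hO.
have [B oO hO] := of_ i c ac; exists B; last exact/hO.
by split=> //; exists i => y cy /(hO _ cy).
Qed.

HB.instance Definition _ (R : realType) (V : normedModType R) (X : charted V) :=
  isOpenTopological.Build (point_of X) (@charted_openT R V X)
    (@charted_openI R V X) (@charted_open_bigU R V X).

Definition compatible (R : realType) (V : normedModType R) (T : Type)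
    (c c' : chart V T) : Prop :=
  open (cmap c @` (cdom c `&` cdom c')) /\
  smooth_on (cmap c @` (cdom c `&` cdom c')) (cmap c' \o cinv c).

Definition is_manifold (R : realType) (V : normedModType R) (X : charted V)
    : Prop :=
  [/\ hausdorff_space X,
      @second_countable X,
      (forall p : X, exists2 c, atlas c & cdom c p),
      (forall c, @atlas _ _ X c -> {in cdom c, cancel (cmap c) (cinv c)}) &
      (forall c c', @atlas _ _ X c -> atlas c' -> compatible c c')].

(* Charts of the maximal atlas. *)
Definition coordinate_system (R : realType) (V : normedModType R)
    (X : charted V) (c : chart V X) : Prop :=
  [/\ open (cdom c), open (cimg c),
      {in cdom c, cancel (cmap c) (cinv c)} &
      forall c', atlas c' -> compatible c c' /\ compatible c' c].

(* A chart of the atlas around [p]; the default value, with empty domain, is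
   never used on a manifold. *)
Definition chart_at (R : realType) (V : normedModType R) (X : charted V)
    (p : X) : chart V X :=
  xget (Chart set0 (fun _ => 0) (fun _ => p)) [set c | atlas c /\ cdom c p].

Definition model_space (R : realType) (V : normedModType R) : charted V :=
  @Charted R V V [set Chart setT idfun idfun].

Definition prod_chart (R : realType) (V W : normedModType R) (S T : Type)
    (c : chart V S) (d : chart W T) : chart (V * W)%type (S * T) :=
  Chart [set z | cdom c z.1 /\ cdom d z.2]
        (fun z => (cmap c z.1, cmap d z.2))
        (fun x => (cinv c x.1, cinv d x.2)).

Definition prod_space (R : realType) (V W : normedModType R)
    (X : charted V) (Y : charted W) : charted (V * W)%type :=
  @Charted R (V * W)%type (X * Y)%type
    [set e | exists c d, [/\ @atlas _ _ X c, @atlas _ _ Y d &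
                             e = prod_chart c d]].

(* Smooth structure on the target [Q] of a quotient map [q] that is injective
   near every point. *)
Definition quot_chart (R : realType) (V : normedModType R) (S Q : Type)
    (q : S -> Q) (c : chart V S) (W : set S) : chart V Q :=
  Chart (q @` W)
        (fun y => xget 0 [set x | exists u, [/\ W u, q u = y & cmap c u = x]])
        (q \o cinv c).

Definition quot_space (R : realType) (V : normedModType R) (X : charted V)
    (Q : Type) (q : X -> Q) : charted V :=
  @Charted R V Q
    [set d | exists (c : chart V X) (W : set X),
       [/\ atlas c, open W, W `<=` cdom c, {in W &, injective q} &
           d = quot_chart q c W]].

(* A tangent vector at [p] is represented by its components in the preferred
   chart at [p]: the tangent space at every point is a copy of [V]. *)

Definition mdiff (R : realType) (V W : normedModType R) (X : charted V)
    (Y : charted W) (f : X -> Y) (p : X) : V -> W :=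
  'd (cmap (chart_at (f p)) \o f \o cinv (chart_at p)) (cmap (chart_at p) p).

Definition smooth_at (R : realType) (V W : normedModType R) (X : charted V)
    (Y : charted W) (f : X -> Y) (p : X) : Prop :=
  {for p, continuous f} /\
  smooth_near (cmap (chart_at p) p)
    (cmap (chart_at (f p)) \o f \o cinv (chart_at p)).

Definition smooth (R : realType) (V W : normedModType R) (X : charted V)
    (Y : charted W) (f : X -> Y) : Prop :=
  forall p, smooth_at f p.

(* The tangent vector at [p] with components [a] in the chart [c]. *)
Definition frame (R : realType) (V : normedModType R) (X : charted V)
    (c : chart V X) (p : X) (a : V) : V :=
  'd (cmap (chart_at p) \o cinv c) (cmap c p) a.

(* The components in the chart [c] of the tangent vector [v] at [p]. *)
Definition coords (R : realType) (V : normedModType R) (X : charted V)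
    (c : chart V X) (p : X) (v : V) : V :=
  'd (cmap c \o cinv (chart_at p)) (cmap (chart_at p) p) v.

Definition fsmooth_at (R : realType) (V : normedModType R) (X : charted V)
    (f : X -> R) (p : X) : Prop :=
  smooth_near (cmap (chart_at p) p) (f \o cinv (chart_at p) : V -> R^o).

Definition fderive (R : realType) (V : normedModType R) (X : charted V)
    (f : X -> R) (p : X) (v : V) : R :=
  'd (f \o cinv (chart_at p) : V -> R^o) (cmap (chart_at p) p) v.

Definition vf_in (R : realType) (V : normedModType R) (X : charted V)
    (c : chart V X) (Y : X -> V) : V -> V :=
  fun x => coords c (cinv c x) (Y (cinv c x)).

Definition vsmooth_at (R : realType) (V : normedModType R) (X : charted V)
    (Y : X -> V) (p : X) : Prop :=
  smooth_near (cmap (chart_at p) p) (vf_in (chart_at p) Y).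

Definition bracket (R : realType) (V : normedModType R) (X : charted V)
    (Y Z : X -> V) (p : X) : V :=
  let c := chart_at p in
  'd (vf_in c Z) (cmap c p) (Y p) - 'd (vf_in c Y) (cmap c p) (Z p).

Definition tangent_chart (R : realType) (V : normedModType R) (X : charted V)
    (c : chart V X) : chart (V * V)%type (X * V) :=
  Chart [set u | cdom c u.1]
        (fun u => (cmap c u.1, coords c u.1 u.2))
        (fun z => (cinv c z.1, frame c (cinv c z.1) z.2)).

Definition tangent_bundle (R : realType) (V : normedModType R) (X : charted V)
    : charted (V * V)%type :=
  @Charted R (V * V)%type (X * V)%type
    [set e | exists2 c, @atlas _ _ X c & e = tangent_chart c].

Definition tproj (R : realType) (V : normedModType R) (X : charted V)
    (u : tangent_bundle X) : X := u.1.

Definition pushforward (R : realType) (V W : normedModType R) (X : charted V)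
    (Y : charted W) (f : X -> Y) (u : tangent_bundle X) : tangent_bundle Y :=
  (f u.1, mdiff f u.1 u.2).

Definition is_riemannian (R : realType) (V : normedModType R) (X : charted V)
    (h : X -> V -> V -> R) : Prop :=
  [/\ (forall p u v, h p u v = h p v u),
      (forall p (a : R) u v w, h p (a *: u + v) w = a * h p u w + h p v w),
      (forall p v, v != 0 -> 0 < h p v v) &
      (forall c, @atlas _ _ X c -> forall a b, smooth_on (cimg c)
         (fun x => h (cinv c x) (frame c (cinv c x) a) (frame c (cinv c x) b)
                   : R^o))].

Definition isometric (R : realType) (V W : normedModType R) (X : charted V)
    (Y : charted W) (h : X -> V -> V -> R) (h' : Y -> W -> W -> R)
    (f : X -> Y) : Prop :=
  forall p u v, h' (f p) (mdiff f p u) (mdiff f p v) = h p u v.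

Definition curve_length (R : realType) (V : normedModType R) (X : charted V)
    (h : X -> V -> V -> R) (gam : model_space R^o -> X) : \bar R :=
  (\int[@lebesgue_measure R]_(t in `[0%R, 1%R])
    (let v := mdiff gam t (1 : R^o) in Num.sqrt (h (gam t) v v))%:E)%E.

Definition riemannian_distance (R : realType) (V : normedModType R)
    (X : charted V) (h : X -> V -> V -> R) (p q : X) : \bar R :=
  ereal_inf [set l | exists gam : model_space R^o -> X,
    [/\ smooth gam, gam (0 : R) = p, gam (1 : R) = q & l = curve_length h gam]].

Definition metric_complete (R : realType) (V : normedModType R)
    (X : charted V) (h : X -> V -> V -> R) : Prop :=
  forall u : nat -> X,
    (forall e : R, 0 < e -> exists N : nat, forall i j : nat,
       (N <= i)%N -> (N <= j)%N ->
       (riemannian_distance h (u i) (u j) < e%:E)%E) ->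
    exists x : X, u @ \oo --> x.

Definition connected_space (T : topologicalType) : Prop :=
  [set: T] !=set0 /\ connected [set: T].

Definition null_homotopic_loops (R : realType) (T : topologicalType) : Prop :=
  forall gam : R -> T,
    {within `[0, 1]%classic, continuous gam} -> gam 0 = gam 1 ->
    exists H : R * R -> T,
      [/\ {within `[0, 1]%classic `*` `[0, 1]%classic, continuous H},
          (forall t, 0 <= t <= 1 -> H (t, 0) = gam t /\ H (t, 1) = gam 0) &
          (forall s, 0 <= s <= 1 -> H (0, s) = gam 0 /\ H (1, s) = gam 0)].

(* A linear connection is represented by its covariant derivatives
   [nabla p v Y], for [v] tangent at [p] and [Y] a vector field which is smooth
   near [p]; nothing is said about the other [Y]. *)
Definition is_connection (R : realType) (V : normedModType R) (X : charted V)
    (nabla : X -> V -> (X -> V) -> V) : Prop :=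
  [/\ (forall p Y (a : R) u v, vsmooth_at Y p ->
         nabla p (a *: u + v) Y = a *: nabla p u Y + nabla p v Y),
      (forall p v Y Z, vsmooth_at Y p -> vsmooth_at Z p ->
         nabla p v (fun q => Y q + Z q) = nabla p v Y + nabla p v Z),
      (forall p v f Y, fsmooth_at f p -> vsmooth_at Y p ->
         nabla p v (fun q => f q *: Y q) =
           fderive f p v *: Y p + f p *: nabla p v Y) &
      (forall p Y Z, vsmooth_at Y p -> vsmooth_at Z p ->
         vsmooth_at (fun q => nabla q (Y q) Z) p)].

Definition torsion_free (R : realType) (V : normedModType R) (X : charted V)
    (nabla : X -> V -> (X -> V) -> V) : Prop :=
  forall p Y Z, vsmooth_at Y p -> vsmooth_at Z p ->
    nabla p (Y p) Z - nabla p (Z p) Y - bracket Y Z p = 0.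

Definition curvature_free (R : realType) (V : normedModType R) (X : charted V)
    (nabla : X -> V -> (X -> V) -> V) : Prop :=
  forall p Y Z T, vsmooth_at Y p -> vsmooth_at Z p -> vsmooth_at T p ->
    nabla p (Y p) (fun q => nabla q (Z q) T)
    - nabla p (Z p) (fun q => nabla q (Y q) T)
    - nabla p (bracket Y Z p) T = 0.

Definition flat (R : realType) (V : normedModType R) (X : charted V)
    (nabla : X -> V -> (X -> V) -> V) : Prop :=
  torsion_free nabla /\ curvature_free nabla.

Definition dual_connection (R : realType) (V : normedModType R)
    (X : charted V) (h : X -> V -> V -> R)
    (nabla nabla' : X -> V -> (X -> V) -> V) : Prop :=
  is_connection nabla' /\
  forall p v Y Z, vsmooth_at Y p -> vsmooth_at Z p ->
    fderive (fun q => h q (Y q) (Z q)) p v =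
      h p (nabla p v Y) (Z p) + h p (Y p) (nabla' p v Z).

Record dually_flat (R : realType) (n : nat) := DuallyFlat {
  df_space :> charted 'rV[R]_n;
  df_metric : df_space -> 'rV[R]_n -> 'rV[R]_n -> R;
  df_conn : df_space -> 'rV[R]_n -> (df_space -> 'rV[R]_n) -> 'rV[R]_n;
  df_manifold : is_manifold df_space;
  df_riemannian : is_riemannian df_metric;
  df_connection : is_connection df_conn;
  df_flat : flat df_conn;
  df_dual_flat : exists2 nabla', dual_connection df_metric df_conn nabla' &
                                 flat nabla' }.

Definition affine_coordinates (R : realType) (n : nat) (M : dually_flat R n)
    (c : chart 'rV[R]_n M) : Prop :=
  coordinate_system c /\
  forall i j p, cdom c p ->
    df_conn p (frame c p (delta_mx ord0 i))
      (fun q => frame c q (delta_mx ord0 j)) = 0.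

Definition affine (R : realType) (n d : nat) (M : dually_flat R n)
    (M' : dually_flat R d) (f : M -> M') : Prop :=
  smooth f /\
  forall p, exists (c : chart 'rV[R]_n M) (c' : chart 'rV[R]_d M'),
    [/\ affine_coordinates c, affine_coordinates c', cdom c p, cdom c' (f p) &
        exists (A : 'M[R]_(n, d)) (B : 'rV[R]_d), forall q, cdom c q ->
          cdom c' (f q) /\ cmap c' (f q) = cmap c q *m A + B].

Definition isometric_affine_immersion (R : realType) (n d : nat)
    (M : dually_flat R n) (M' : dually_flat R d) (f : M -> M') : Prop :=
  [/\ affine f, (forall p, injective (mdiff f p)) &
      isometric (@df_metric _ _ M) (@df_metric _ _ M') f].

(* No axiom here: the axioms of a Kähler manifold are in [is_kahler]. *)
Record hermitian_data (R : realType) (V : normedModType R) := HermitianData {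
  hm_space :> charted V;
  hm_metric : hm_space -> V -> V -> R;
  hm_J : hm_space -> V -> V }.

Definition kahler_form (R : realType) (V : normedModType R)
    (N : hermitian_data V) (p : N) (a b : V) : R :=
  hm_metric p (hm_J p a) b.

Definition holomorphic (R : realType) (V W : normedModType R)
    (N : hermitian_data V) (N' : hermitian_data W) (f : N -> N') : Prop :=
  smooth f /\ forall p a, mdiff f p (hm_J p a) = hm_J (f p) (mdiff f p a).

Definition hm_isometric (R : realType) (V W : normedModType R)
    (N : hermitian_data V) (N' : hermitian_data W) (f : N -> N') : Prop :=
  isometric (@hm_metric _ _ N) (@hm_metric _ _ N') f.

(* Coordinates [(x, y)] such that [x + i y] is a holomorphic coordinate
   system, i.e. J(d/dx_k) = d/dy_k and J(d/dy_k) = - d/dx_k. *)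
Definition holomorphic_coordinates (R : realType) (n : nat)
    (N : hermitian_data ('rV[R]_n * 'rV[R]_n)%type)
    (c : chart ('rV[R]_n * 'rV[R]_n)%type N) : Prop :=
  coordinate_system c /\
  forall p x y, cdom c p -> hm_J p (frame c p (x, y)) = frame c p (- y, x).

Definition closed_2form (R : realType) (V : normedModType R) (X : charted V)
    (w : X -> V -> V -> R) : Prop :=
  forall c, @atlas _ _ X c -> forall a1 a2 a3 x, cimg c x ->
    let w_ a b := (fun z => w (cinv c z) (frame c (cinv c z) a)
                                         (frame c (cinv c z) b) : R^o) in
    'D_a1 (w_ a2 a3) x + 'D_a2 (w_ a3 a1) x + 'D_a3 (w_ a1 a2) x = 0.

Definition is_kahler (R : realType) (n : nat)
    (N : hermitian_data ('rV[R]_n * 'rV[R]_n)%type) : Prop :=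
  [/\ is_manifold N,
      is_riemannian (@hm_metric _ _ N),
      (forall p : N, exists2 c, holomorphic_coordinates c & cdom c p),
      (forall (p : N) a b, hm_metric p (hm_J p a) (hm_J p b) = hm_metric p a b) &
      closed_2form (@kahler_form _ _ N)].

Definition analytic_metric (R : realType) (n : nat)
    (N : hermitian_data ('rV[R]_n * 'rV[R]_n)%type) : Prop :=
  forall c, @holomorphic_coordinates R n N c -> forall a b x y, cimg c (x, y) ->
    analytic_at (fun z : 'rV[R]_(n + n) =>
      let p := cinv c (lsubmx z, rsubmx z) in
      hm_metric p (frame c p a) (frame c p b)) (row_mx x y).

Definition regular_kahler (R : realType) (n : nat)
    (N : hermitian_data ('rV[R]_n * 'rV[R]_n)%type) : Prop :=
  [/\ connected_space N, null_homotopic_loops R N,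
      metric_complete (@hm_metric _ _ N) & analytic_metric N].

Definition is_connector (R : realType) (n : nat) (M : dually_flat R n)
    (K : tangent_bundle M -> ('rV[R]_n * 'rV[R]_n)%type -> 'rV[R]_n) : Prop :=
  (forall u (a : R) v w, K u (a *: v + w) = a *: K u v + K u w) /\
  forall Y Z : M -> 'rV[R]_n,
    (forall p, vsmooth_at Y p) -> (forall p, vsmooth_at Z p) ->
    forall p, K (p, Z p)
        (mdiff ((fun q => (q, Z q)) : M -> tangent_bundle M) p (Y p)) =
      df_conn p (Y p) Z.

Definition connector (R : realType) (n : nat) (M : dually_flat R n) :
    tangent_bundle M -> ('rV[R]_n * 'rV[R]_n)%type -> 'rV[R]_n :=
  xget (fun _ _ => 0) [set K | @is_connector R n M K].

Definition dombrowski (R : realType) (n : nat) (M : dually_flat R n)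
    : hermitian_data ('rV[R]_n * 'rV[R]_n)%type :=
  let pi_ u := mdiff (@tproj _ _ M) u in
  let K := @connector R n M in
  @HermitianData R _ (tangent_bundle M)
    (fun u a b => df_metric (tproj u) (pi_ u a) (pi_ u b)
                  + df_metric (tproj u) (K u a) (K u b))
    (fun u a => xget 0 [set b | pi_ u b = - K u a /\ K u b = pi_ u a]).

Definition orbit_of (T : Type) (G : set (T -> T)) (u : T) : set T :=
  [set w | exists2 g, G g & w = g u].

Definition orbit_space (T : Type) (G : set (T -> T)) : Type :=
  {O : set T | exists u, O = orbit_of G u}.

Definition orbit_proj (T : Type) (G : set (T -> T)) (u : T) : orbit_space G :=
  exist _ (orbit_of G u) (ex_intro _ u erefl).

Definition orbit_repr (T : Type) (G : set (T -> T)) (y : orbit_space G) : T :=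
  sval (cid (proj2_sig y)).

(* The metric and the complex structure are transported by [q], which is
   meant to be a local diffeomorphism. *)
Definition quot_hermitian_data (R : realType) (V : normedModType R)
    (N : hermitian_data V) (Q : Type) (q : N -> Q) : hermitian_data V :=
  let q' : N -> quot_space q := q in
  @HermitianData R V (quot_space q)
    (fun y a b => xget 0 [set r | exists u a' b',
       [/\ q u = y, mdiff q' u a' = a, mdiff q' u b' = b &
           r = hm_metric u a' b']])
    (fun y a => xget 0 [set b | exists u a',
       [/\ q u = y, mdiff q' u a' = a & b = mdiff q' u (hm_J u a')]]).

Definition parallel_frame (R : realType) (n : nat) (M : dually_flat R n)
    (X : 'I_n -> M -> 'rV[R]_n) : Prop :=
  [/\ (forall i p, vsmooth_at (X i) p),
      (forall i p v, df_conn p v (X i) = 0) &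
      (forall p, row_free (\matrix_i X i p))].

Definition translate (R : realType) (n : nat) (M : dually_flat R n)
    (X : 'I_n -> M -> 'rV[R]_n) (t : 'rV[R]_n) (u : tangent_bundle M)
    : tangent_bundle M :=
  (u.1, u.2 + \sum_i t ord0 i *: X i u.1).

Definition lattice_generated (R : realType) (n : nat) (M : dually_flat R n)
    (X : 'I_n -> M -> 'rV[R]_n) : set (tangent_bundle M) :=
  [set u | exists k : 'I_n -> int, u.2 = \sum_i (k i)%:~R *: X i u.1].

Definition generates (R : realType) (n : nat) (M : dually_flat R n)
    (X : 'I_n -> M -> 'rV[R]_n) (L : set (tangent_bundle M)) : Prop :=
  parallel_frame X /\ L = lattice_generated X.

(* All the generators of [L] give the same translations. *)
Definition Gamma (R : realType) (n : nat) (M : dually_flat R n)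
    (L : set (tangent_bundle M)) : set (tangent_bundle M -> tangent_bundle M) :=
  [set g | exists2 X, generates X L &
           exists k : 'I_n -> int, g = translate X (\row_i (k i)%:~R)].

Definition lattice_proj (R : realType) (n : nat) (M : dually_flat R n)
    (L : set (tangent_bundle M)) (u : dombrowski M) : orbit_space (Gamma L) :=
  orbit_proj (Gamma L) u.

Definition lattice_quotient (R : realType) (n : nat) (M : dually_flat R n)
    (L : set (tangent_bundle M)) : hermitian_data ('rV[R]_n * 'rV[R]_n)%type :=
  quot_hermitian_data (@lattice_proj R n M L).

Definition quotient_map (R : realType) (n : nat) (M : dually_flat R n)
    (L : set (tangent_bundle M)) (u : tangent_bundle M) : lattice_quotient L :=
  @lattice_proj R n M L u.

Definition integer_vector (R : realType) (n : nat) : {pred 'rV[R]_n} :=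
  fun t => t \is a mxOver Num.int.

Lemma integer_vector_zmod_closed (R : realType) (n : nat) :
  zmod_closed (@integer_vector R n).
Proof.
split=> [|s t /mxOverP si /mxOverP ti]; apply/mxOverP => i j; rewrite !mxE.
  exact: rpred0.
by apply: rpredB; [exact: si|exact: ti].
Qed.

HB.instance Definition _ (R : realType) (n : nat) :=
  GRing.isZmodClosed.Build 'rV[R]_n (@integer_vector R n)
    (@integer_vector_zmod_closed R n).

Notation torus_quot R n := (@Quotient.quot 'rV[R]_n (@integer_vector R n)).

Definition torus (R : realType) (n : nat) : zmodType :=
  torus_quot R n.

Definition torus_proj (R : realType) (n : nat) (t : 'rV[R]_n) : torus R n :=
  (\pi_(torus_quot R n) t)%qT.

Definition torus_repr (R : realType) (n : nat) (a : torus R n) : 'rV[R]_n :=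
  repr (a : torus_quot R n).

Definition torus_space (R : realType) (n : nat) : charted 'rV[R]_n :=
  quot_space (@torus_proj R n : model_space 'rV[R]_n -> torus R n).

Definition lie_hom (R : realType) (n d : nat) (rho : torus R n -> torus R d)
    : Prop :=
  (forall a b, rho (a + b) = rho a + rho b) /\
  smooth (rho : torus_space R n -> torus_space R d).

(* The action on TM/Gamma(L) induced by a generator [X] of [L]. *)
Definition lattice_action (R : realType) (n : nat) (M : dually_flat R n)
    (L : set (tangent_bundle M)) (X : 'I_n -> M -> 'rV[R]_n)
    (a : torus R n) (y : lattice_quotient L) : lattice_quotient L :=
  quotient_map L (translate X (torus_repr a) (orbit_repr y)).

Definition effective_kahler_action (R : realType) (n : nat)
    (N : hermitian_data ('rV[R]_n * 'rV[R]_n)%type) (Phi : torus R n -> N -> N)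
    : Prop :=
  [/\ [/\ (forall x, Phi 0 x = x),
          (forall a b x, Phi (a + b) x = Phi a (Phi b x)) &
          smooth ((fun z => Phi z.1 z.2) : prod_space (torus_space R n) N -> N)],
      (forall a, (forall x, Phi a x = x) -> a = 0),
      (forall a, holomorphic (Phi a)) &
      (forall a, hm_isometric (Phi a))].

Definition free_points (R : realType) (n : nat)
    (N : hermitian_data ('rV[R]_n * 'rV[R]_n)%type) (Phi : torus R n -> N -> N)
    : set N :=
  [set x | forall a, Phi a x = x -> a = 0].

Definition diffeo_onto (R : realType) (V W : normedModType R) (X : charted V)
    (Y : charted W) (U : set Y) (F : X -> Y) : Prop :=
  [/\ open U, smooth F, (forall x, U (F x)) &
      exists G : Y -> X,
        cancel F G /\ forall y, U y -> F (G y) = y /\ smooth_at G y].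

Definition toric_parametrization (R : realType) (n : nat)
    (M : dually_flat R n) (N : hermitian_data ('rV[R]_n * 'rV[R]_n)%type)
    (Phi : torus R n -> N -> N) (L : set (tangent_bundle M))
    (X : 'I_n -> M -> 'rV[R]_n) (F : lattice_quotient L -> N) : Prop :=
  [/\ generates X L, diffeo_onto (free_points Phi) F, holomorphic F,
      hm_isometric F &
      forall a y, F (lattice_action X a y) = Phi a (F y)].

Definition torification (R : realType) (n : nat) (M : dually_flat R n)
    (N : hermitian_data ('rV[R]_n * 'rV[R]_n)%type) (Phi : torus R n -> N -> N)
    : Prop :=
  [/\ is_kahler N, connected_space N, effective_kahler_action Phi &
      exists L X F, @toric_parametrization R n M N Phi L X F].

Definition regular_torification (R : realType) (n : nat) (M : dually_flat R n)
    (N : hermitian_data ('rV[R]_n * 'rV[R]_n)%type) (Phi : torus R n -> N -> N)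
    : Prop :=
  torification M Phi /\ regular_kahler N.

Definition compatible_covering (R : realType) (n : nat) (M : dually_flat R n)
    (N : hermitian_data ('rV[R]_n * 'rV[R]_n)%type) (Phi : torus R n -> N -> N)
    (tau : tangent_bundle M -> N) : Prop :=
  exists L X F, @toric_parametrization R n M N Phi L X F /\
                tau = F \o quotient_map L.

(* Between regular torifications the lift m_{tau' tau}(f) exists and is unique;
   both facts belong to its description as "the" lift. *)
Definition is_lift (R : realType) (n d : nat)
    (M : dually_flat R n) (M' : dually_flat R d)
    (N : hermitian_data ('rV[R]_n * 'rV[R]_n)%type)
    (N' : hermitian_data ('rV[R]_d * 'rV[R]_d)%type)
    (tau : tangent_bundle M -> N) (tau' : tangent_bundle M' -> N')
    (f : M -> M') (m : N -> N') : Prop :=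
  unique (fun l : N -> N' =>
    smooth l /\ l \o tau = tau' \o pushforward f) m.

(* rho_{tau' tau}(f), when [m] is the lift of [f]. *)
Definition is_lift_hom (R : realType) (n d : nat)
    (N : hermitian_data ('rV[R]_n * 'rV[R]_n)%type)
    (N' : hermitian_data ('rV[R]_d * 'rV[R]_d)%type)
    (Phi : torus R n -> N -> N) (Phi' : torus R d -> N' -> N')
    (m : N -> N') (rho : torus R n -> torus R d) : Prop :=
  unique (fun r : torus R n -> torus R d =>
    lie_hom r /\ forall a, m \o Phi a = Phi' (r a) \o m) rho.

(* Main.v *)
Require Import Defs.
From HB Require Import structures.
From mathcomp Require Import all_boot all_order all_algebra.
From mathcomp Require Import ring_quotient.
From mathcomp Require Import all_classical all_reals all_analysis.

(** A lift [m] of [f] and its torus homomorphism [rho] are each the only object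
    with a defining property, so each of the four identities follows once its
    right-hand side is shown to have that property.

    For the lifts, [m32 \o m21 \o tau1 = m32 \o tau2 \o f1_* =
    tau3 \o f2_* \o f1_*], and the chain rule [(f2 \o f1)_* = f2_* \o f1_*]
    ([pushforward_comp]) turns this into the equation that defines the lift of
    [f2 \o f1]; likewise [idfun_* = idfun] ([pushforward_id]) shows that
    [idfun] lifts [idfun]. For the homomorphisms, [rho32 \o rho21] and [idfun]
    satisfy the equivariance relations of [m32 \o m21] and [idfun], which by
    then are [m31] and [m11].

    The analytic content is that smooth maps are closed under composition
    ([smooth_comp]), both between the manifolds [N_i] and between the tori. In
    linear spaces this is [Ck_comp]: a directional derivative of [g \o f] is a
    sum of products of a coordinate of a derivative of [f] with a partial
    derivative of [g] composed with [f], which allows an induction on the order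
    of differentiability. The passage to manifolds uses that the expression of
    [g \o f] in charts is, near the base point, the composite of the
    expressions of [g] and of [f] ([chart_expr_comp]). This rests only on
    the properties of an atlas collected in [topological_atlas], which the tori
    have as well ([torus_topological_atlas]). *)

Set Implicit Arguments.
Unset Strict Implicit.
Unset Printing Implicit Defensive.

Import Order.TTheory GRing.Theory Num.Theory.
Import numFieldNormedType.Exports.

Local Open Scope classical_set_scope.
Local Open Scope ring_scope.

(** * Calculus of maps of class C^k in normed spaces *)

(** [f] and [g] have the same first order expansion at [x], and differentials
    are unique. *)
Lemma near_eq_diff (R : realType) (V W : normedModType R) (f g : V -> W) x :
  (\near x, f x = g x) -> differentiable f x ->
  differentiable g x /\ 'd g x = 'd f x :> (V -> W).
Proof.
move=> fg df; have fgx := nbhs_singleton fg.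
have fg0 : \forall y \near (0 : V), (f \o shift x) y = (g \o shift x) y.
  by move: fg; rewrite (near_shift 0) /=; apply: filterS => y; rewrite subr0.
have gE : g \o shift x = cst (g x) + 'd f x +o_ 0 id.
  have /eqaddoP fE := diff_locally df.
  apply/eqaddoP => e e0; have := fE e e0; move: fg0.
  apply: filterS2 => y /= ye.
  have -> // : (f \o shift x - (cst (f x) + 'd f x)) y =
               (g \o shift x - (cst (g x) + 'd f x)) y.
  by rewrite !fctE /= ye fgx.
have dE : 'd g x = 'd f x :> (V -> W).
  by apply: (diff_unique _ gE); exact: diff_continuous.
split=> //; apply/diff_locallyP; rewrite dE; split=> //.
exact: diff_continuous.
Qed.

Section Ck.
Variable R : realType.
Implicit Types (U V W : normedModType R).

Lemma Ck_sub U V k (A B : set U) (f : U -> V) :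
  B `<=` A -> Ck k A f -> Ck k B f.
Proof.
move=> BA; elim: k f => [|k IH] f /=; first by move=> cf x /BA /cf.
by case=> df Df; split=> [x /BA /df //|v]; exact: IH.
Qed.

Lemma Ck_eq U V k (A : set U) (f g : U -> V) :
  open A -> (forall x, A x -> f x = g x) -> Ck k A f -> Ck k A g.
Proof.
move=> oA; elim: k f g => [|k IH] f g fg /=.
  move=> cf x Ax; have fgx : \near x, f x = g x.
    by near=> y; apply: fg; near: y; exact: open_nbhs_nbhs.
  have : g @ x --> f x by exact: cvg_trans (near_eq_cvg fgx) (cf x Ax).
  by rewrite (fg x Ax).
have near_fg x : A x -> \near x, f x = g x.
  by move=> Ax; near=> y; apply: fg; near: y; exact: open_nbhs_nbhs.
case=> df Df; split=> [x Ax|v].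
  by have [] := near_eq_diff (near_fg x Ax) (df x Ax).
by apply: IH (Df v) => x Ax; exact/near_eq_derive/near_fg.
Unshelve. all: by end_near. Qed.

Lemma CkW U V k (A : set U) (f : U -> V) : Ck k.+1 A f -> Ck k A f.
Proof.
elim: k f => [|k IH] f /=.
  by case=> df _ x Ax; exact/differentiable_continuous/df.
by case=> df Df; split=> // v; apply: IH; exact: Df.
Qed.

Lemma Ck_cst U V k (A : set U) (w : V) : Ck k A (cst w).
Proof.
elim: k w => [|k IH] w /=; first by move=> x _; exact: cvg_cst.
split=> [x _|v]; first exact: differentiable_cst.
by rewrite (_ : (fun x => _) = cst 0) //; apply/funext => x; exact: derive_cst.
Qed.

Lemma CkD U V k (A : set U) (f g : U -> V) : open A ->
  Ck k A f -> Ck k A g -> Ck k A (f + g).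
Proof.
move=> oA; elim: k f g => [|k IH] f g /=.
  by move=> cf cg x Ax; exact: continuousD (cf x Ax) (cg x Ax).
case=> df Df [dg Dg]; split=> [x Ax|v].
  exact: differentiableD (df x Ax) (dg x Ax).
apply: (Ck_eq oA) (IH _ _ (Df v) (Dg v)) => x Ax.
by rewrite deriveD //; apply: diff_derivable; [exact: df|exact: dg].
Qed.

Lemma Ck_sum U V k (A : set U) (I : Type) (r : seq I) (f : I -> U -> V) :
  open A -> (forall i, Ck k A (f i)) -> Ck k A (\sum_(i <- r) f i).
Proof.
move=> oA fA; elim/big_rec: _ => [|i g _ gA]; first exact: Ck_cst.
exact: CkD.
Qed.

Lemma Ck_linear U V W k (A : set U) (l : {linear V -> W}) (f : U -> V) :
  open A -> continuous l -> Ck k A f -> Ck k A (l \o f).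
Proof.
move=> oA cl; elim: k f => [|k IH] f /=.
  by move=> cf x Ax; apply: continuous_comp (cf x Ax) (cl _).
case=> df Df; split=> [x Ax|v].
  exact: differentiable_comp (df x Ax) (linear_differentiable _ cl).
apply: (Ck_eq oA) (IH _ (Df v)) => x Ax /=.
have [dfx dl] := (df x Ax, linear_differentiable (f x) cl).
rewrite (deriveE _ dfx) (deriveE _ (differentiable_comp dfx dl)).
by rewrite (diff_comp dfx dl) /= (diff_lin _ cl).
Qed.

Lemma scale_is_bilinear V :
  bilinear_for
    (GRing.Scale.Law.clone _ _ *:%R _) (GRing.Scale.Law.clone _ _ *:%R _)
    (fun (a : R^o) (v : V) => a *: v).
Proof.
split=> [v|a] b x y /=; first by rewrite scalerDl scalerA.
by rewrite scalerDr !scalerA mulrC.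
Qed.

(** The Leibniz rule, as the chain rule for the bilinear map
    [(a, v) |-> a *: v]. *)
Lemma diff_scale U V (a : U -> R^o) (f : U -> V) x :
  differentiable a x -> differentiable f x ->
  differentiable (fun y => a y *: f y) x /\
  forall v, 'd (fun y => a y *: f y) x v = a x *: 'd f x v + 'd a x v *: f x.
Proof.
move=> da df.
pose m := bilinear_isBilinear.Build R R^o V V _ _ _ (scale_is_bilinear V).
pose s : {bilinear R^o -> V -> V} := HB.pack (fun (a : R^o) (v : V) => a *: v) m.
have cs : continuous (fun p : R^o * V => s p.1 p.2) by exact: scale_continuous.
have dp : differentiable (fun y => (a y, f y)) x by exact: differentiable_pair.
have ds := differentiable_bilin (a x, f x) cs.
have E : (fun y => a y *: f y) = (fun p => s p.1 p.2) \o (fun y => (a y, f y)).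
  by [].
rewrite E; split=> [|v]; first exact: differentiable_comp.
by rewrite (diff_comp dp ds) /= (diff_bilin _ cs) (diff_pair da df).
Qed.

Lemma CkZ U V k (A : set U) (a : U -> R^o) (f : U -> V) : open A ->
  Ck k A a -> Ck k A f -> Ck k A (fun x => a x *: f x).
Proof.
move=> oA; elim: k a f => [|k IH] a f.
  by move=> ca cf x Ax; exact: (@cvgZ _ _ _ _ _ a f _ _ (ca x Ax) (cf x Ax)).
move=> aA fA; have [[da Da] [df Df]] := (aA, fA).
split=> [x Ax|v]; first by have [] := diff_scale (da x Ax) (df x Ax).
have := CkD oA (IH _ _ (CkW aA) (Df v)) (IH _ _ (Da v) (CkW fA)).
apply: (Ck_eq oA) => x Ax.
have [dz dzE] := diff_scale (da x Ax) (df x Ax).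
by rewrite (deriveE _ dz) dzE -(deriveE _ (df x Ax)) -(deriveE _ (da x Ax)).
Qed.

(** Finite dimension, in the form that lets a varying direction be split along a
    fixed frame with smoothly varying coefficients. *)
Definition has_coordinates V : Prop :=
  exists (I : finType) (e : I -> V) (l : I -> {linear V -> R^o}),
    (forall i, continuous (l i)) /\ forall v, v = \sum_i l i v *: e i.

(** The derivative of [g \o f] along [v] at [x] is the sum over [i] of
    [l i ('D_v f x) *: 'D_(e i) g (f x)]. Finite dimension enters here: as [Ck]
    controls the derivatives of [g] along fixed directions only, the varying
    direction ['D_v f x] is split along a fixed frame. *)
Lemma Ck_comp U V W k (A : set U) (B : set V) (f : U -> V) (g : V -> W) :
  has_coordinates V -> open A -> (forall x, A x -> B (f x)) ->
  Ck k A f -> Ck k B g -> Ck k A (g \o f).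
Proof.
move=> [I [e [l [cl lE]]]] oA AB; elim: k g => [|k IH] g.
  by move=> cf cg x Ax; apply: continuous_comp (cf x Ax) (cg _ (AB x Ax)).
move=> fA gB; have [[df Df] [dg Dg]] := (fA, gB).
split=> [x Ax|v]; first exact: differentiable_comp (df x Ax) (dg _ (AB x Ax)).
have : Ck k A (\sum_i (fun x => l i ('D_v f x) *: 'D_(e i) g (f x))).
  apply: Ck_sum => // i; apply: CkZ => //.
    exact: Ck_linear oA (cl i) (Df v).
  by apply: (IH (fun y => 'D_(e i) g y)); [exact: CkW|exact: Dg].
apply: (Ck_eq oA) => x Ax.
have [dfx dgx] := (df x Ax, dg _ (AB x Ax)).
rewrite (deriveE _ (differentiable_comp dfx dgx)) (diff_comp dfx dgx) /=.
rewrite -(deriveE _ dfx).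
rewrite [in RHS](lE ('D_v f x)) linear_sum fct_sumE.
by apply: eq_bigr => i _; rewrite linearZ (deriveE _ dgx).
Qed.

End Ck.

Lemma has_coordinates_rV (R : realType) n : has_coordinates 'rV[R]_n.
Proof.
have coord_linear i : linear (fun v : 'rV[R]_n => v ord0 i : R^o).
  by move=> a u v; rewrite !mxE.
pose m i := GRing.isLinear.Build _ _ _ _ _ (coord_linear i).
pose l i : {linear 'rV[R]_n -> R^o} :=
  HB.pack (fun v : 'rV[R]_n => v ord0 i : R^o) (m i).
exists 'I_n, (delta_mx ord0), l.
split=> [i|v]; [exact: coord_continuous|exact: row_sum_delta].
Qed.

Lemma has_coordinates_prod (R : realType) (V W : normedModType R) :
  has_coordinates V -> has_coordinates W -> has_coordinates (V * W)%type.
Proof.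
move=> [I [e [l [cl lE]]]] [J [e' [l' [cl' lE']]]].
have lin (k : I + J) : linear (fun v : V * W =>
    match k with inl i => l i v.1 | inr j => l' j v.2 end).
  by case: k => k a u v; rewrite linearP.
pose m k := GRing.isLinear.Build _ _ _ _ _ (lin k).
pose L k : {linear (V * W)%type -> R^o} := HB.pack (fun v : V * W =>
  match k with inl i => l i v.1 | inr j => l' j v.2 end) (m k).
exists (I + J)%type, (fun k =>
  match k with inl i => (e i, 0) | inr j => (0, e' j) end), L.
split=> [[i|j] v|[v w]].
- by apply: continuous_comp; [exact: cvg_fst|exact: cl].
- by apply: continuous_comp; [exact: cvg_snd|exact: cl'].
rewrite big_sumType /=.
rewrite [in LHS](lE v) [in LHS](lE' w).
apply/eqP; rewrite xpair_eqE; apply/andP; split; apply/eqP => /=.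
  rewrite !raddf_sum /= [X in _ + X]big1 ?addr0 // => j _.
  by rewrite scaler0.
rewrite !raddf_sum /= [X in X + _]big1 ?add0r // => j _.
by rewrite scaler0.
Qed.

Section Smooth_near.
Variable R : realType.
Implicit Types (U V W : normedModType R).

Lemma smooth_near_diff U V x (f : U -> V) :
  smooth_near x f -> differentiable f x.
Proof. by case=> A [_ Ax /(_ 1%N) [df _]]; exact: df. Qed.

Lemma smooth_near_eq U V x (f g : U -> V) :
  (\near x, f x = g x) -> smooth_near x f -> smooth_near x g.
Proof.
rewrite -nbhs_nearE nbhsE => -[B [oB Bx] fg] [A [oA Ax fA]].
exists (A `&` B); split=> [||k]; [exact: openI|by []|].
apply: (Ck_eq (openI oA oB)) (Ck_sub (@subIsetl _ A B) (fA k)).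
by move=> y [_ By]; exact: fg.
Qed.

Lemma smooth_near_id U (x : U) : smooth_near x (idfun : U -> U).
Proof.
exists setT; split=> //; first exact: openT.
case=> [|k]; first by move=> y _; exact: cvg_id.
split=> [y _|v]; first exact: ex_diff.
apply: (Ck_eq openT) (Ck_cst k setT v) => y _.
by rewrite deriveE ?diff_val.
Qed.

Lemma smooth_near_comp U V W x (f : U -> V) (g : V -> W) : has_coordinates V ->
  smooth_near x f -> smooth_near (f x) g -> smooth_near x (g \o f).
Proof.
move=> cV [A [oA Ax fA]] [B [oB Bfx gB]].
have cf y : A y -> {for y, continuous f} by exact: (fA 0%N).
exists (A `&` f @^-1` B); have oAB : open (A `&` f @^-1` B).
  rewrite openE => y [Ay By]; apply: filterI; first exact: open_nbhs_nbhs.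
  by apply: cf => //; exact: open_nbhs_nbhs.
split=> // k.
by apply: (Ck_comp cV oAB _ (Ck_sub (@subIsetl _ _ _) (fA k)) (gB k)) => y [].
Qed.

End Smooth_near.

(** * Maps between manifolds read in charts *)

(** What makes the charts homeomorphisms between open sets. Smoothness and
    differentials being read in one preferred chart per point, this is what
    composition rests on; it is shared by manifolds and by the tori, whose
    charts come from a quotient map. *)
Definition topological_atlas (R : realType) (V : normedModType R)
    (X : charted V) : Prop :=
  [/\ (forall p : X, exists2 c, atlas c & cdom c p),
      (forall c, @atlas _ _ X c -> {in cdom c, cancel (cmap c) (cinv c)}) &
      (forall c c', @atlas _ _ X c -> atlas c' ->
         open (cmap c @` (cdom c `&` cdom c')))].

Lemma manifold_topological_atlas (R : realType) (V : normedModType R)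
  (X : charted V) : is_manifold X -> topological_atlas X.
Proof.
by case=> _ _ cover can compat; split=> // c c' ac /(compat _ _ ac)[].
Qed.

Section Chart.
Variables (R : realType) (V : normedModType R) (X : charted V).
Hypothesis tX : topological_atlas X.
Implicit Types (p : X) (c : chart V X).

Lemma chart_atP p : atlas (chart_at p) /\ cdom (chart_at p) p.
Proof.
have [cover _ _] := tX; have [c ac cp] := cover p.
by apply: (@xgetPex _ _ [set c | atlas c /\ cdom c p]); exists c.
Qed.

Lemma cinvK c p : atlas c -> cdom c p -> cinv c (cmap c p) = p.
Proof. by have [_ can _] := tX => ac cp; apply: can => //; rewrite inE. Qed.

Lemma open_cimg c : atlas c -> open (cimg c).
Proof. by have [_ _ ov] := tX => ac; have := ov _ _ ac ac; rewrite setIid. Qed.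

(** In another chart [c'], the domain of [c] is read as the overlap
    [cmap c' @` (cdom c' `&` cdom c)], which is open. *)
Lemma open_cdom c : atlas c -> open (cdom c).
Proof.
have [_ _ ov] := tX => ac; suff : charted_open (cdom c) by [].
move=> c' ac'; exists (cmap c' @` (cdom c' `&` cdom c)); first exact: ov.
move=> _ [q c'q <-]; rewrite cinvK //; split=> [cq|[r [c'r cr] rq]].
  by exists q.
by rewrite -(cinvK ac' c'q) -rq cinvK.
Qed.

Lemma cinv_continuous c x : atlas c -> cimg c x -> {for x, continuous (cinv c)}.
Proof.
move=> ac cx A [B [oB Bcx BA]]; have [P oP PB] := oB c ac.
have : nbhs x (P `&` cimg c).
  apply: open_nbhs_nbhs; split; first exact: openI oP (open_cimg ac).
  by split=> //; apply/PB.
by apply: filterS => y [Py cy]; apply: BA; apply/PB.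
Qed.

End Chart.

(** Both [smooth_at] and [mdiff] are defined through this local expression. *)
Definition chart_expr (R : realType) (V W : normedModType R) (X : charted V)
    (Y : charted W) (f : X -> Y) (p : X) : V -> W :=
  cmap (chart_at (f p)) \o f \o cinv (chart_at p).

Section Smooth.
Variable R : realType.
Implicit Types U V W : normedModType R.

Lemma chart_expr_id V (X : charted V) (p : X) : topological_atlas X ->
  \forall x \near cmap (chart_at p) p, x = chart_expr (idfun : X -> X) p x.
Proof.
move=> tX; have [ac cp] := chart_atP tX p.
have : nbhs (cmap (chart_at p) p) (cimg (chart_at p)).
  by apply: open_nbhs_nbhs; split; [exact: open_cimg|exists p].
by apply: filterS => _ [q cq <-]; rewrite /chart_expr /= (cinvK tX).
Qed.

(** The charts at [f p] cancel out at the points which [f] sends into the domain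
    of the preferred chart at [f p]; by continuity these fill a
    neighbourhood of [p]. *)
Lemma chart_expr_comp U V W (X : charted U) (Y : charted V) (Z : charted W)
  (f : X -> Y) (g : Y -> Z) (p : X) :
  topological_atlas X -> topological_atlas Y -> {for p, continuous f} ->
  \forall x \near cmap (chart_at p) p,
    (chart_expr g (f p) \o chart_expr f p) x = chart_expr (g \o f) p x.
Proof.
move=> tX tY cf; have [ac cp] := chart_atP tX p.
have [acf cfp] := chart_atP tY (f p).
have cfi : {for cmap (chart_at p) p, continuous (f \o cinv (chart_at p))}.
  apply: continuous_comp; first by apply: cinv_continuous => //; exists p.
  by rewrite (cinvK tX).
have : nbhs (cmap (chart_at p) p)
    ((f \o cinv (chart_at p)) @^-1` cdom (chart_at (f p))).
  apply: cfi; apply: open_nbhs_nbhs; split; first exact: open_cdom.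
  by rewrite /= (cinvK tX).
by apply: filterS => x /= fx; rewrite /chart_expr /= (cinvK tY).
Qed.

Lemma chart_expr_base V W (X : charted V) (Y : charted W) (f : X -> Y) (p : X) :
  topological_atlas X ->
  chart_expr f p (cmap (chart_at p) p) = cmap (chart_at (f p)) (f p).
Proof.
by move=> tX; have [ac cp] := chart_atP tX p; rewrite /chart_expr /= (cinvK tX).
Qed.

Lemma smooth_id V (X : charted V) : topological_atlas X ->
  smooth (idfun : X -> X).
Proof.
move=> tX p; split; first exact: cvg_id.
exact: smooth_near_eq (chart_expr_id p tX) (smooth_near_id _).
Qed.

Lemma mdiff_id V (X : charted V) (p : X) : topological_atlas X ->
  mdiff (idfun : X -> X) p = idfun.
Proof.
move=> tX.
have [_ dE] := near_eq_diff (chart_expr_id p tX)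
  (smooth_near_diff (smooth_near_id _)).
by rewrite /mdiff -/(chart_expr _ _) dE diff_val.
Qed.

Lemma smooth_comp U V W (X : charted U) (Y : charted V) (Z : charted W)
  (f : X -> Y) (g : Y -> Z) : has_coordinates V ->
  topological_atlas X -> topological_atlas Y ->
  smooth f -> smooth g -> smooth (g \o f).
Proof.
move=> cV tX tY sf sg p; have [cf lf] := sf p; have [cg lg] := sg (f p).
split; first exact: continuous_comp.
apply: smooth_near_eq (chart_expr_comp g tX tY cf) _.
by apply: smooth_near_comp => //; rewrite chart_expr_base.
Qed.

Lemma mdiff_comp U V W (X : charted U) (Y : charted V) (Z : charted W)
  (f : X -> Y) (g : Y -> Z) p :
  topological_atlas X -> topological_atlas Y ->
  smooth_at f p -> smooth_at g (f p) ->
  mdiff (g \o f) p = mdiff g (f p) \o mdiff f p.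
Proof.
move=> tX tY [cf /smooth_near_diff df] [_ /smooth_near_diff dg].
rewrite -(chart_expr_base f p tX) in dg.
have [_ dE] :=
  near_eq_diff (chart_expr_comp g tX tY cf) (differentiable_comp df dg).
rewrite -[LHS]/('d (chart_expr (g \o f) p) (cmap (chart_at p) p) : _ -> _).
by rewrite dE (diff_comp df dg) -/(chart_expr f p) (chart_expr_base f p tX).
Qed.

Lemma pushforward_id V (X : charted V) : topological_atlas X ->
  Defs.pushforward (idfun : X -> X) = idfun.
Proof.
by move=> tX; apply/funext => -[p v]; rewrite /Defs.pushforward mdiff_id.
Qed.

Lemma pushforward_comp U V W (X : charted U) (Y : charted V) (Z : charted W)
  (f : X -> Y) (g : Y -> Z) : topological_atlas X -> topological_atlas Y ->
  smooth f -> smooth g ->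
  Defs.pushforward (g \o f) = Defs.pushforward g \o Defs.pushforward f.
Proof.
move=> tX tY sf sg; apply/funext => -[p v].
by rewrite /Defs.pushforward /= (mdiff_comp tX tY (sf p) (sg _)).
Qed.

End Smooth.

(** * The atlas of the torus *)

Lemma open_preimage_sub (R : realType) (V : normedModType R) (k : V)
  (A : set V) : open A -> open ((fun u => u - k) @^-1` A).
Proof.
move=> oA; apply: open_comp => // u _.
by apply: cvgB; [exact: cvg_id|exact: cvg_cst].
Qed.

Section Torus.
Variables (R : realType) (n : nat).
Local Notation q := (@torus_proj R n).

Lemma torus_projP (u v : 'rV[R]_n) :
  q u = q v <-> u - v \in @integer_vector R n.
Proof. by rewrite /torus_proj Quotient.idealrBE; split=> [->//|/eqP //]. Qed.

(** Two points of a ball of radius one half differ by less than 1 in each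
    coordinate, and 0 is the only integer of absolute value less than 1. *)
Lemma torus_proj_inj_ball (p u v : 'rV[R]_n) :
  ball p 2^-1 u -> ball p 2^-1 v -> q u = q v -> u = v.
Proof.
move=> [_ pu] [_ pv] /torus_projP /mxOverP iuv.
apply/subr0_eq/matrixP => i j; rewrite !mxE; apply/eqP/negP => /negP uv0.
have := iuv i j; rewrite !mxE => /norm_intr_ge1 /(_ uv0).
apply/negP; rewrite -ltNge.
have := ltrD (pu i j) (pv i j); rewrite -[2^-1]mul1r -splitr => puv.
rewrite -(subrKA (p i j)); rewrite (le_lt_trans _ puv) //.
by rewrite (distrC (p i j) (u i j)) ler_normD.
Qed.

Lemma quot_chart_torusK (W : set 'rV[R]_n) (u : 'rV[R]_n) :
  {in W &, injective q} -> W u ->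
  cmap (quot_chart q (Chart setT idfun idfun) W) (q u) = u.
Proof.
move=> injq Wu /=; apply: xget_unique; first by exists u.
by move=> _ [v [Wv qvu <-]]; apply: injq; rewrite ?inE.
Qed.

(** The overlap of the charts given by [W] and [W'], read in the first chart, is
    the intersection of [W] with the union of the integer translates of [W'],
    hence open. *)
Lemma torus_topological_atlas : topological_atlas (torus_space R n).
Proof.
have openW (W : set (model_space 'rV[R]_n)) : open W -> @open 'rV[R]_n W.
  move=> /(_ (Chart setT idfun idfun)) [] // P oP WP.
  have {}WP x : W x <-> P x by apply: WP; exists x.
  by rewrite (_ : W = P) //; apply/seteqP; split=> x /WP.
split=> [a|_ [_ [W [-> oW _ injq ->]]]|].
- pose p := torus_repr a; have qp : q p = a by rewrite /torus_proj reprK.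
  pose W := interior (ball p 2^-1).
  have Wp : W p by exact: nbhsx_ballx.
  exists (quot_chart q (Chart setT idfun idfun) W); last by exists p.
  exists (Chart setT idfun idfun), W; split=> //.
  + move=> _ ->; exists W; first exact: open_interior.
    by move=> u _; split.
  + move=> u v /set_mem/interior_subset pu /set_mem/interior_subset pv.
    exact: torus_proj_inj_ball pu pv.
- by move=> _ /set_mem [u Wu <-]; rewrite quot_chart_torusK.
move=> _ _ [_ [W [-> /openW oW _ injq ->]]] [_ [W' [-> /openW oW' _ _ ->]]].
rewrite (_ : _ @` _ = W `&` \bigcup_(k in [set k | k \in @integer_vector R n])
    ((fun u => u - k) @^-1` W')).
  apply: openI => //; apply: bigcup_open => k _.
  exact: open_preimage_sub.
apply/seteqP; split=> u.
  move=> [_ [[v Wv <-] [w W'w wv]] <-]; rewrite quot_chart_torusK //.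
  split=> //; exists (v - w); first by apply/torus_projP.
  by rewrite /= subKr.
move=> [Wu [k ik W'uk]]; exists (q u); last by rewrite quot_chart_torusK.
split; first by exists u.
exists (u - k) => //; apply/torus_projP.
by rewrite addrAC subrr add0r rpredN.
Qed.

End Torus.

(** * Lifts and their torus homomorphisms *)

Lemma lie_hom_id (R : realType) (n : nat) :
  lie_hom (idfun : torus R n -> torus R n).
Proof. by split=> //; apply: smooth_id; exact: torus_topological_atlas. Qed.

Lemma lie_hom_comp (R : realType) (n d e : nat) (r : torus R n -> torus R d)
  (s : torus R d -> torus R e) : lie_hom r -> lie_hom s -> lie_hom (s \o r).
Proof.
move=> [rD smr] [sD sms]; split=> [a b|]; first by rewrite /= rD sD.
apply: (smooth_comp _ _ _ smr sms); first exact: has_coordinates_rV.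
  exact: torus_topological_atlas.
exact: torus_topological_atlas.
Qed.

Lemma torification_atlas (R : realType) (n : nat) (M : dually_flat R n)
  (N : hermitian_data ('rV[R]_n * 'rV[R]_n)%type) (Phi : torus R n -> N -> N) :
  regular_torification M Phi -> topological_atlas N.
Proof.
by move=> [[[mN _ _ _ _] _ _ _] _]; exact: manifold_topological_atlas.
Qed.

Theorem proposition9p9 (R : realType) (n1 n2 n3 : nat)
    (M1 : dually_flat R n1) (M2 : dually_flat R n2) (M3 : dually_flat R n3)
    (N1 : hermitian_data ('rV[R]_n1 * 'rV[R]_n1)%type)
    (N2 : hermitian_data ('rV[R]_n2 * 'rV[R]_n2)%type)
    (N3 : hermitian_data ('rV[R]_n3 * 'rV[R]_n3)%type)
    (Phi1 : torus R n1 -> N1 -> N1) (Phi2 : torus R n2 -> N2 -> N2)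
    (Phi3 : torus R n3 -> N3 -> N3)
    (tau1 : tangent_bundle M1 -> N1) (tau2 : tangent_bundle M2 -> N2)
    (tau3 : tangent_bundle M3 -> N3)
    (f1 : M1 -> M2) (f2 : M2 -> M3)
    (m21 : N1 -> N2) (m32 : N2 -> N3) (m31 : N1 -> N3) (m11 : N1 -> N1)
    (rho21 : torus R n1 -> torus R n2) (rho32 : torus R n2 -> torus R n3)
    (rho31 : torus R n1 -> torus R n3) (rho11 : torus R n1 -> torus R n1) :
  connected_space M1 -> connected_space M2 -> connected_space M3 ->
  regular_torification M1 Phi1 -> regular_torification M2 Phi2 ->
  regular_torification M3 Phi3 ->
  compatible_covering Phi1 tau1 -> compatible_covering Phi2 tau2 ->
  compatible_covering Phi3 tau3 ->
  isometric_affine_immersion f1 -> isometric_affine_immersion f2 ->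
  is_lift tau1 tau2 f1 m21 -> is_lift tau2 tau3 f2 m32 ->
  is_lift tau1 tau3 (f2 \o f1) m31 -> is_lift tau1 tau1 idfun m11 ->
  is_lift_hom Phi1 Phi2 m21 rho21 -> is_lift_hom Phi2 Phi3 m32 rho32 ->
  is_lift_hom Phi1 Phi3 m31 rho31 -> is_lift_hom Phi1 Phi1 m11 rho11 ->
  [/\ m31 = m32 \o m21,
      m11 = idfun,
      rho31 = rho32 \o rho21 &
      rho11 = idfun].
Proof.
move=> _ _ _ /torification_atlas tN1 /torification_atlas tN2 _ _ _ _.
move=> [[sf1 _] _ _] [[sf2 _] _ _].
move=> [[sm21 m21E] _] [[sm32 m32E] _] [_ m31_unique] [_ m11_unique].
move=> [[hr21 r21E] _] [[hr32 r32E] _] [_ r31_unique] [_ r11_unique].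
have tM1 := manifold_topological_atlas (df_manifold M1).
have tM2 := manifold_topological_atlas (df_manifold M2).
have cN2 : has_coordinates ('rV[R]_n2 * 'rV[R]_n2)%type.
  by apply: has_coordinates_prod; exact: has_coordinates_rV.
have m31E : m31 = m32 \o m21.
  apply: m31_unique; split; first exact: smooth_comp.
  rewrite (pushforward_comp tM1 tM2 sf1 sf2).
  apply/funext => u; move/funeqP: m21E => /(_ u) /= ->.
  by move/funeqP: m32E => /(_ (Defs.pushforward f1 u)) /= ->.
have m11E : m11 = idfun.
  apply: m11_unique; split; first exact: smooth_id.
  by rewrite pushforward_id.
split=> //.
  apply: r31_unique; split=> [|a]; first exact: lie_hom_comp.
  rewrite m31E; apply/funext => x /=.
  move/funeqP: (r21E a) => /(_ x) /= ->.
  by move/funeqP: (r32E (rho21 a)) => /(_ (m21 x)) /= ->.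
by apply: r11_unique; split=> [|a]; [exact: lie_hom_id|rewrite m11E].
Qed.
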